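(* For every $r\ge1$, the boolean number of the Ferrers graph of the staircase shape $\sigma_r=(r,r-1,\ldots,2,1)$ is the $r$-th Genocchi number of the second kind: $\beta(\sigma_r)=g(r)$.
   Context: Boolean number: for a finite simple graph $G$, the integer $\beta(G)$ is the (well-defined, isomorphism-invariant) quantity determined recursively by $\beta(\emptyset)=1$ for the empty graph, $\beta(\delta_n)=0$ where $\delta_n$ ($n\ge1$) is the graph of $n$ isolated vertices, and, for any edge $e$ of $G$, $\beta(G)=\beta(G-e)+\beta(G/e)+\beta(G-[e])$. Here $G-e$ deletes the edge $e$; $G/e$ contracts $e$ and then removes loops and redundant (parallel) edges; $G-[e]$ removes $e$ together with both its end vertices (and all edges incident to them). It is known that the recursion is independent of choices, and that $\beta(G)$ is the number of spheres of dimension $|G|-1$ in the wedge of spheres to which the boolean complex of $G$ is homotopy equivalent (the boolean complex being the regular cell complex of the simplicial poset of words in distinct vertices of $G$, ordered by substring inclusion, modulo commuting letters that are non-adjacent in $G$). Ferrers graph: for a Ferrers shape $\lambda=(\lambda_1,\ldots,\lambda_r)$ (integers $\lambda_1\ge\cdots\ge\lambda_r\ge0$) the Ferrers graph has vertex set $\{x_1,\ldots,x_r\}\sqcup\{y_1,\ldots,y_{\lambda_1}\}$ and an edge $\{x_i,y_j\}$ exactly when $\lambda_i\ge j$; $\beta(\lambda)$ denotes its boolean number. Genocchi numbers of the second kind (median Genocchi numbers) $g(r)$, $r\ge1$: $g(r)=G(r,1)$, where $G(1,x)=1$ and $G(r,x)=(x+1)^2G(r-1,x+1)-x(x+1)G(r-1,x)$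 for all $x\ge0$ and $r\ge2$. (The sequence begins $1,2,8,56,608,\ldots$.) *)

(* Defs.v *)
From mathcomp Require Import all_boot all_order all_algebra.
From mathcomp Require Import zify.

Set Implicit Arguments.
Unset Strict Implicit.
Unset Printing Implicit Defensive.

Import GRing.Theory Num.Theory.

Record sgraph := SGraph {
  vertex :> finType;
  adj : rel vertex;
  adj_sym : symmetric adj;
  adj_irr : irreflexive adj }.

Definition arcs (G : sgraph) : pred (G * G) := [pred p | adj p.1 p.2].
Arguments arcs : clear implicits.

Section Operations.
Variables (G : sgraph) (x y : G).

Definition del_edge_adj : rel G :=
  fun u v => adj u v && ~~ (((u == x) && (v == y)) || ((u == y) && (v == x))).

Fact del_edge_sym : symmetric del_edge_adj.
Proof.
by move=> u v; rewrite /del_edge_adj adj_sym orbC [(u == y) && _]andbC [(u == x) && _]andbC.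
Qed.

Fact del_edge_irr : irreflexive del_edge_adj.
Proof. by move=> u; rewrite /del_edge_adj adj_irr. Qed.

Definition del_edge : sgraph := SGraph del_edge_sym del_edge_irr.

(* The endpoint y is merged into x, so the contracted graph lives on the
   vertices other than y; being irreflexive and a relation, its adjacency has
   no loops and no parallel edges. *)
Definition merge (z : G) : G := if z == y then x else z.

Definition contract_adj : rel {z : G | z != y} :=
  fun u v => (u != v) &&
    [exists a, exists b, [&& merge a == val u, merge b == val v & adj a b]].

Fact contract_sym : symmetric contract_adj.
Proof.
move=> u v; rewrite /contract_adj eq_sym; congr andb.
apply/existsP/existsP => -[a /existsP[b /and3P[ha hb hab]]];
  by exists b; apply/existsP; exists a; rewrite ha hb adj_sym.
Qed.

Fact contract_irr : irreflexive contract_adj.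
Proof. by move=> u; rewrite /contract_adj eqxx. Qed.

Definition contract : sgraph := SGraph contract_sym contract_irr.

Definition del_ends_adj : rel {z : G | (z != x) && (z != y)} :=
  fun u v => adj (val u) (val v).

Fact del_ends_sym : symmetric del_ends_adj.
Proof. by move=> u v; exact: adj_sym. Qed.

Fact del_ends_irr : irreflexive del_ends_adj.
Proof. by move=> u; exact: adj_irr. Qed.

Definition del_ends : sgraph := SGraph del_ends_sym del_ends_irr.

End Operations.

(* One evaluation of the recursion, with an arbitrary choice of edge at each
   step: by [boolean_number_edge], [boolean_number_unique] and
   [boolean_number_iso] below, the choices are immaterial.
   The bound [complexity] decreases strictly along the three operations, so
   the recursion never runs out of fuel. *)
Fixpoint boolean_number_rec (k : nat) (G : sgraph) : nat :=
  if k isn't k'.+1 then 0 else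
  if [pick p in arcs G] is Some (x, y) then
    boolean_number_rec k' (del_edge x y) + boolean_number_rec k' (contract x y)
      + boolean_number_rec k' (del_ends x y)
  else #|G| == 0.

Definition complexity (G : sgraph) : nat := #|G| ^ 3 + #|arcs G|.

Definition boolean_number (G : sgraph) : nat :=
  boolean_number_rec (complexity G).+1 G.

Lemma card_arcs_le (G : sgraph) : #|arcs G| <= #|G| ^ 2.
Proof. by rewrite -mulnn -card_prod max_card. Qed.

Lemma card_contract (G : sgraph) (x y : G) : #|contract x y| = #|G|.-1.
Proof.
rewrite card_sig -(cardC1 y); exact: eq_card.
Qed.

Lemma card_del_ends (G : sgraph) (x y : G) :
  x != y -> #|del_ends x y| = #|G|.-2.
Proof.
move=> xy; rewrite card_sig.
have -> : #|[pred z | (z != x) && (z != y)]| = #|~: [set x; y]|.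
  by apply: eq_card => z; rewrite !inE negb_or.
by rewrite cardsCs setCK cards2 xy subn2.
Qed.

Lemma adj_neq (G : sgraph) (x y : G) : adj x y -> x != y.
Proof. by apply: contraTneq => ->; rewrite adj_irr. Qed.

Lemma complexity_card (G H : sgraph) :
  #|H| < #|G| -> complexity H < complexity G.
Proof.
move=> HG; have := card_arcs_le H; rewrite /complexity.
move: #|H| #|G| #|arcs H| #|arcs G| HG => m n a b mn am.
apply: leq_trans (leq_addr _ _).
have m2n : m ^ 2 * m.+1 <= m ^ 2 * n by rewrite leq_mul2l mn orbT.
have n2n : m ^ 2 * n < n ^ 2 * n by rewrite ltn_pmul2r ?ltn_exp2r //; lia.
by move: m2n n2n; rewrite mulnS -!expnSr; lia.
Qed.

Section Complexity.
Variables (G : sgraph) (x y : G).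
Hypothesis xy : adj x y.

Lemma complexity_del_edge : complexity (del_edge x y) < complexity G.
Proof.
rewrite /complexity ltn_add2l; apply: proper_card; apply/properP; split.
  by apply/subsetP=> -[u v]; rewrite !inE /= => /andP[].
by exists (x, y); rewrite !inE /= ?xy // /del_edge_adj !eqxx andbF.
Qed.

Let G_gt0 : 0 < #|G|. Proof. by apply/card_gt0P; exists x. Qed.

Lemma complexity_contract : complexity (contract x y) < complexity G.
Proof. by apply: complexity_card; rewrite card_contract prednK. Qed.

Lemma complexity_del_ends : complexity (del_ends x y) < complexity G.
Proof.
apply: complexity_card; rewrite card_del_ends ?adj_neq //; lia.
Qed.
End Complexity.

Lemma boolean_number_recE k G :
  complexity G < k -> boolean_number_rec k G = boolean_number G.
Proof.
rewrite /boolean_number.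
suff H m : complexity G < k -> complexity G < m ->
    boolean_number_rec k G = boolean_number_rec m G by move=> ?; exact: H.
elim: k m G => [|k IH] [|m] G //=; rewrite !ltnS => Gk Gm.
case: pickP => // -[x y]; rewrite inE /= => xy.
have := (complexity_del_edge xy, complexity_contract x y,
         complexity_del_ends xy).
move=> [[c1 c2] c3].
by congr (_ + _ + _); apply: IH; apply: leq_trans; eauto.
Qed.

(* Colourings of some of the vertices by q colours, proper on the coloured
   ones. Their number is a polynomial in q, whose value at -1 is, up to sign,
   the boolean number. *)
Definition partial_col (G : sgraph) q : {set {ffun G -> option 'I_q}} :=
  [set f : {ffun G -> option 'I_q} | [forall u, forall v,
     adj u v ==> ((f u != f v) || (f u == None))]].

Lemma partial_colP (G : sgraph) q (f : {ffun G -> option 'I_q}) :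
  reflect (forall u v, adj u v -> f u = f v -> f u = None)
          (f \in partial_col G q).
Proof.
rewrite inE; apply: (iffP 'forall_forallP) => [H u v uv fuv|H u v].
  by have := H u v; rewrite uv fuv eqxx /= => /eqP.
apply/implyP => uv; case: eqP => //= fuv; apply/eqP; exact: H fuv.
Qed.

Lemma card_bij (A B : finType) (P : {set A}) (Q : {set B})
    (f : A -> B) (g : B -> A) :
  {in P, forall a, f a \in Q /\ g (f a) = a} ->
  {in Q, forall b, g b \in P /\ f (g b) = b} -> #|P| = #|Q|.
Proof.
move=> fP gQ; have <- : f @: P = Q.
  apply/setP => b; apply/imsetP/idP => [[a aP ->]|bQ]; first by case: (fP a aP).
  by exists (g b); case: (gQ b bQ).
rewrite card_in_imset // => a a' aP a'P E.
by case: (fP a aP) => _ <-; case: (fP a' a'P) => _ <-; rewrite E.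
Qed.

Section PartialColEdge.
Variables (G : sgraph) (x y : G) (q : nat).
Hypothesis xy : adj x y.

Let D := partial_col (del_edge x y) q.

Lemma partial_col_contract :
  #|partial_col (contract x y) q| = #|[set f in D | f x == f y]|.
Proof.
have yx : x != y by apply: adj_neq.
have mP z : merge x y z != y by by rewrite /merge; case: (eqVneq z y).
pose up (g : {ffun contract x y -> option 'I_q}) : {ffun G -> option 'I_q} :=
  [ffun z => g (Sub (merge x y z) (mP z))].
pose down (f : {ffun G -> option 'I_q}) : {ffun contract x y -> option 'I_q} :=
  [ffun z => f (val z)].
apply: (@card_bij _ _ _ _ up down) => [g /partial_colP gP|f].
  split; last first.
    apply/ffunP => z; rewrite !ffunE; congr (g _); apply: val_inj => /=.
    by rewrite /merge (negbTE (valP z)).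
  rewrite inE; apply/andP; split; last first.
    rewrite !ffunE; apply/eqP; congr (g _); apply: val_inj => /=.
    by rewrite /merge eqxx (negbTE yx).
  apply/partial_colP => u v /= /andP[uv nuv]; rewrite !ffunE => guv.
  apply: gP guv; apply/andP; split.
    rewrite -val_eqE /= /merge; move: nuv; have := adj_neq uv.
    case: (eqVneq u y) => [->|uy]; case: (eqVneq v y) => [->|vy];
      by rewrite ?eqxx //= => _; rewrite ?andbT ?orbF ?andbF 1?eq_sym.
  by apply/existsP; exists u; apply/existsP; exists v; rewrite /= !eqxx.
rewrite inE => /andP[/partial_colP fP /eqP fxy].
have fm z : f (merge x y z) = f z by rewrite /merge; case: eqP => // ->.
split; last by apply/ffunP => z; rewrite !ffunE fm.
apply/partial_colP => u v /= /andP[nuv /existsP[a /existsP[b /and3P[]]]].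
move=> /eqP au /eqP bv ab; rewrite !ffunE -au -bv !fm => fab.
apply: fP fab; rewrite /= /del_edge_adj ab /=; apply/negP => E; case/negP: nuv.
rewrite -val_eqE -au -bv /merge.
by case/orP: E => /andP[/eqP-> /eqP->]; rewrite !eqxx (negbTE yx) eqxx.
Qed.

Lemma partial_col_del_ends :
  #|partial_col (del_ends x y) q|
  = #|[set f in D | (f x == f y) && (f x == None)]|.
Proof.
pose up (g : {ffun del_ends x y -> option 'I_q}) : {ffun G -> option 'I_q} :=
  [ffun z => if insub z is Some z' then g z' else None].
pose down (f : {ffun G -> option 'I_q}) : {ffun del_ends x y -> option 'I_q} :=
  [ffun z => f (val z)].
apply: (@card_bij _ _ _ _ up down) => [g /partial_colP gP|f].
  split; last by apply/ffunP => z; rewrite !ffunE valK.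
  rewrite inE !ffunE !insubF ?eqxx ?andbF // !andbT.
  apply/partial_colP => u v /= /andP[uv nuv]; rewrite !ffunE.
  case: insubP => // u' _ Eu; case: insubP => [v' _ Ev|//].
  by apply: gP; rewrite /= /del_ends_adj Eu Ev.
rewrite inE => /andP[/partial_colP fP /andP[/eqP fxy /eqP fx]].
split.
  apply/partial_colP => u v /= uv; rewrite !ffunE; apply: fP.
  have /andP[ux uy] := valP u; rewrite /= /del_edge_adj (uv : is_true (adj (val u) (val v))).
  by rewrite (negbTE ux) (negbTE uy).
apply/ffunP => z; rewrite !ffunE; case: insubP => [z' _ Ez|].
  by rewrite ffunE Ez.
by rewrite negb_and !negbK => /orP[]/eqP-> //; rewrite -fxy.
Qed.

Lemma partial_col_edge :
  #|partial_col G q|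
  = #|[set f in D | (f x == f y) && (f x == None)]|
    + #|[set f in D | f x != f y]|.
Proof.
rewrite -(cardsID [set f : {ffun G -> option 'I_q} | f x == f y]).
congr (_ + _); apply: eq_card => f.
  apply/setIP/setIdP => [[/partial_colP fP]|[/partial_colP fP]].
    rewrite inE => /eqP fxy; rewrite (fP _ _ xy fxy) -fxy (fP _ _ xy fxy) eqxx.
    by split=> //; apply/partial_colP => u v /andP[uv _]; apply: fP.
  case/andP=> /eqP fxy /eqP fx; rewrite inE fxy eqxx; split=> //.
  apply/partial_colP => u v uv.
  case E: (del_edge_adj x y u v); first exact: fP.
  move/negbT: E; rewrite /del_edge_adj uv negbK.
  by case/orP=> /andP[/eqP-> /eqP->] _; rewrite -?fxy.
apply/setDP/setIdP => [[/partial_colP fP]|[/partial_colP fP fxy]].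
  rewrite inE => fxy; split=> //.
  by apply/partial_colP => u v /andP[uv _]; apply: fP.
rewrite inE; split=> //; apply/partial_colP => u v uv fuv.
case E: (del_edge_adj x y u v); first exact: fP fuv.
move/negbT: E; rewrite /del_edge_adj uv negbK.
by case/orP=> /andP[/eqP Eu /eqP Ev]; case/eqP: fxy; rewrite -Eu -Ev.
Qed.

Lemma partial_col_rec :
  #|partial_col G q| + #|partial_col (contract x y) q|
  = #|partial_col (del_edge x y) q| + #|partial_col (del_ends x y) q|.
Proof.
rewrite partial_col_edge partial_col_contract partial_col_del_ends -/D.
rewrite -[#|D|](cardsID [set f : {ffun G -> option 'I_q} | f x == f y]).
rewrite -addnA addnC; congr (_ + _); rewrite addnC; congr (_ + _).
  by apply: eq_card => f; rewrite !inE.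
by apply: eq_card => f; rewrite !inE andbC.
Qed.
End PartialColEdge.

Lemma partial_col_edgeless (G : sgraph) q :
  arcs G =1 pred0 -> #|partial_col G q| = q.+1 ^ #|G|.
Proof.
move=> G0; rewrite -[q in RHS]card_ord -card_option -card_ffun -cardsT.
congr #|pred_of_set _|; apply/setP => f; rewrite in_setT.
by apply/partial_colP => u v uv; have := G0 (u, v); rewrite /arcs /= uv.
Qed.

Definition is_boolean_poly (G : sgraph) (p : {poly int}) : Prop :=
  forall q : nat, p.[q%:R]%R = #|partial_col G q|%:R%R.

Lemma boolean_poly_uniq G p1 p2 :
  is_boolean_poly G p1 -> is_boolean_poly G p2 -> p1 = p2.
Proof.
move=> H1 H2; apply/eqP; rewrite -subr_eq0; apply/negPn/negP => p0.
pose s := [seq (i%:R : int)%R | i <- iota 0 (size (p1 - p2)%R)].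
have s_root : all (root (p1 - p2)%R) s.
  by apply/allP => _ /mapP[i _ ->]; rewrite rootE hornerD hornerN H1 H2 subrr.
have s_uniq : uniq s.
  by rewrite map_inj_uniq ?iota_uniq // => i j /eqP; rewrite eqr_nat => /eqP.
by have := max_poly_roots p0 s_root s_uniq; rewrite size_map size_iota ltnn.
Qed.

Lemma boolean_poly_edge (G : sgraph) (x y : G) p1 p2 p3 : adj x y ->
  is_boolean_poly (del_edge x y) p1 -> is_boolean_poly (contract x y) p2 ->
  is_boolean_poly (del_ends x y) p3 -> is_boolean_poly G (p1 - p2 + p3)%R.
Proof.
move=> xy H1 H2 H3 q; rewrite !hornerD hornerN H1 H2 H3.
have /(congr1 (fun n => n%:R : int)%R) := partial_col_rec q xy.
by rewrite !natrD addrAC => <-; rewrite addrK.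
Qed.

Lemma sign_edge (G : sgraph) (x y : G) (a b c : int) : adj x y ->
  ((-1) ^+ #|G| * (a - b + c)
   = (-1) ^+ #|del_edge x y| * a + (-1) ^+ #|contract x y| * b
     + (-1) ^+ #|del_ends x y| * c)%R.
Proof.
move=> xy; rewrite card_contract card_del_ends ?adj_neq //.
have : 1 < #|G| by rewrite (cardD1 x) (cardD1 y) !inE eq_sym adj_neq.
rewrite /=; case: #|G| => [|[|n]] //= _.
by rewrite !exprS mulrA mulN1r opprK mul1r mulN1r mulNr !mulrDr mulrN.
Qed.

Lemma boolean_poly_exists (G : sgraph) : exists2 p, is_boolean_poly G p &
  ((-1) ^+ #|G| * p.[-1] = (boolean_number G)%:R)%R.
Proof.
have [n] := ubnP (complexity G); elim: n G => // n IH G; rewrite ltnS => Gn.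
rewrite /boolean_number /=; case: pickP => [[x y]|G0].
  rewrite inE /= => xy.
  have lt1 := complexity_del_edge xy; have lt2 := complexity_contract x y.
  have lt3 := complexity_del_ends xy; rewrite !boolean_number_recE //.
  rewrite !natrD.
  have [|p1 H1 <-] := IH (del_edge x y); first exact: leq_trans Gn.
  have [|p2 H2 <-] := IH (contract x y); first exact: leq_trans Gn.
  have [|p3 H3 <-] := IH (del_ends x y); first exact: leq_trans Gn.
  exists (p1 - p2 + p3)%R; first exact: (boolean_poly_edge xy H1 H2 H3).
  by rewrite !hornerD hornerN (sign_edge _ _ _ xy).
exists (('X + 1) ^+ #|G|)%R.
  move=> q; rewrite partial_col_edgeless // horner_exp hornerD hornerX hornerC.
  by rewrite natrX -addn1 natrD.
rewrite horner_exp hornerD hornerX hornerC addNr expr0n.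
by case: #|G| => [|m]; rewrite /= ?mulr1 ?mulr0.
Qed.

Theorem boolean_number_edge (G : sgraph) (x y : G) : adj x y ->
  boolean_number G = boolean_number (del_edge x y)
    + boolean_number (contract x y) + boolean_number (del_ends x y).
Proof.
move=> xy; have [p H E] := boolean_poly_exists G.
have [p1 H1 E1] := boolean_poly_exists (del_edge x y).
have [p2 H2 E2] := boolean_poly_exists (contract x y).
have [p3 H3 E3] := boolean_poly_exists (del_ends x y).
have Ep := boolean_poly_uniq H (boolean_poly_edge xy H1 H2 H3).
apply/eqP; rewrite -(eqr_nat int) !natrD -E -E1 -E2 -E3 Ep.
by rewrite !hornerD hornerN (sign_edge _ _ _ xy).
Qed.

Lemma boolean_number_edgeless (G : sgraph) :
  (forall x y : G, ~~ adj x y) -> boolean_number G = (#|G| == 0).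
Proof.
move=> G0; rewrite /boolean_number /=; case: pickP => // -[x y].
by rewrite inE /= (negbTE (G0 x y)).
Qed.

Lemma boolean_number_iso (G H : sgraph) (f : G -> H) :
  bijective f -> (forall u v, adj (f u) (f v) = adj u v) ->
  boolean_number G = boolean_number H.
Proof.
move=> [g fK gK] fadj; have [p Hp E] := boolean_poly_exists G.
have [p' Hp' E'] := boolean_poly_exists H.
have cGH : #|G| = #|H| by apply: (@bij_eq_card _ _ f); exists g.
suff Ep : is_boolean_poly G p'.
  by apply/eqP; rewrite -(eqr_nat int) -E -E' cGH (boolean_poly_uniq Hp Ep).
move=> q; rewrite Hp'; congr (_%:R)%R.
pose pull (c : {ffun H -> option 'I_q}) : {ffun G -> option 'I_q} :=
  [ffun u => c (f u)].
pose push (c : {ffun G -> option 'I_q}) : {ffun H -> option 'I_q} :=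
  [ffun v => c (g v)].
apply: (@card_bij _ _ _ _ pull push) => c /partial_colP cP.
  split; last by apply/ffunP => v; rewrite !ffunE gK.
  by apply/partial_colP => u v uv; rewrite !ffunE; apply: cP; rewrite fadj.
split; last by apply/ffunP => v; rewrite !ffunE fK.
by apply/partial_colP => u v uv; rewrite !ffunE; apply: cP; rewrite -fadj !gK.
Qed.

Lemma boolean_number_unique (b : sgraph -> nat) :
  (forall G : sgraph, (forall x y : G, ~~ adj x y) -> b G = (#|G| == 0)) ->
  (forall (G : sgraph) (x y : G), adj x y ->
     b G = b (del_edge x y) + b (contract x y) + b (del_ends x y)) ->
  b =1 boolean_number.
Proof.
move=> b0 bE G; have [n] := ubnP (complexity G).
elim: n G => // n IH G; rewrite ltnS => Gn.
case: (pickP (arcs G)) => [[x y] /= xy|G0].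
  rewrite (bE _ _ _ xy) (boolean_number_edge xy).
  by congr (_ + _ + _); apply: IH; apply: leq_trans Gn;
     [exact: complexity_del_edge|exact: complexity_contract
     |exact: complexity_del_ends].
have G0' (x y : G) : ~~ adj x y.
  by apply/negP => xy; have := G0 (x, y); rewrite /arcs /= xy.
by rewrite b0 // boolean_number_edgeless.
Qed.

Section Ferrers.
Variable lambda : seq nat.

(* Rows and columns are numbered from 0: [inl i] is x_(i+1) and [inr j] is
   y_(j+1), so that lambda_(i+1) >= j+1 reads [j < nth 0 lambda i]. *)
Definition ferrers_adj (u v : 'I_(size lambda) + 'I_(head 0 lambda)) : bool :=
  match u, v with
  | inl i, inr j => j < nth 0 lambda i
  | inr j, inl i => j < nth 0 lambda i
  | _, _ => false
  end.

Fact ferrers_sym : symmetric ferrers_adj.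
Proof. by case=> ? [?|?]. Qed.

Fact ferrers_irr : irreflexive ferrers_adj.
Proof. by case. Qed.

Definition ferrers : sgraph := SGraph ferrers_sym ferrers_irr.
End Ferrers.

Definition is_ferrers_shape (lambda : seq nat) : bool := sorted geq lambda.

Definition staircase (r : nat) : seq nat := rev (iota 1 r).

Lemma staircase_shape r : is_ferrers_shape (staircase r).
Proof. by rewrite /is_ferrers_shape rev_sorted iota_sorted. Qed.

(* The value at r = 0 is arbitrary. *)
Fixpoint genocchi2_at (r x : nat) : int :=
  match r with
  | 0 => 0
  | 1 => 1
  | r'.+1 => (x%:R + 1) ^+ 2 * genocchi2_at r' x.+1
             - x%:R * (x%:R + 1) * genocchi2_at r' x
  end%R.

Definition genocchi2 (r : nat) : int := genocchi2_at r 1.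

(* Main.v *)
Require Import Defs.
From mathcomp Require Import all_boot all_order all_algebra.
From mathcomp Require Import zify ring.

Set Implicit Arguments.
Unset Strict Implicit.
Unset Printing Implicit Defensive.

Import GRing.Theory.

(** Up to the sign (-1)^|G|, the boolean number of G is the value at q = -1 of
    the polynomial counting the partial proper colourings of G with q colours,
    so it is enough to count those of the staircase Ferrers graph.

    Read from the shortest column to the longest, the columns of the staircase
    meet the first row, the first two rows, and so on: the graph is the half
    graph, with x_i adjacent to y_j exactly when i <= j.  Colour its vertices in
    the order x_0, y_0, x_1, y_1, ...  The vertex y_j must avoid the colours used
    on x_0, ..., x_j, so all that matters is the number k of colours seen so far
    on the x side.  The next x is left blank or repeats a seen colour in k + 1
    ways and brings a new colour in q - k ways; the y after it is then blank or
    has an unseen colour, in q + 1 - k, respectively q - k, ways.  The number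
    F(r, k) of ways of colouring the last r pairs thus satisfies F(0, k) = 1 and
      F(r, k) = (k + 1) (q + 1 - k) F(r - 1, k) + (q - k)^2 F(r - 1, k + 1).
    At q = -1 this reads
      F(r, k) = (k + 1)^2 F(r - 1, k + 1) - k (k + 1) F(r - 1, k),
    the recurrence of the Genocchi numbers with r shifted by one:
    F(r, k) = G(r + 1, k) ([col_poly_genocchi]).  The graph has 2r vertices,
    so the sign is +1, and its boolean number is F(r, 0), which is
    F(r - 1, 1) = G(r, 1) because the factor k cancels the other term.

    The pairwise colouring is carried out in two steps: the y side is summed out
    first, for a fixed colouring of the x side ([card_partial_col_half]), and the
    recurrence comes from the value taken by the first x ([sum_seen]). *)

(** * Half graphs *)

Definition half_adj n (u v : 'I_n + 'I_n) : bool :=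
  match u, v with
  | inl i, inr j | inr j, inl i => i <= j
  | _, _ => false
  end.

Fact half_sym n : symmetric (@half_adj n).
Proof. by case=> ? [?|?]. Qed.

Fact half_irr n : irreflexive (@half_adj n).
Proof. by case. Qed.

Definition half_graph n : sgraph := SGraph (@half_sym n) (@half_irr n).

Lemma size_staircase r : size (staircase r) = r.
Proof. by rewrite size_rev size_iota. Qed.

Lemma nth_staircase r i : i < r -> nth 0 (staircase r) i = r - i.
Proof.
by move=> ir; rewrite nth_rev size_iota // nth_iota; lia.
Qed.

Lemma head_staircase r : head 0 (staircase r) = r.
Proof. by case: r => // r; rewrite -nth0 nth_staircase. Qed.

(** The columns are renumbered backwards, from the shortest one. *)
Lemma boolean_number_staircase r :
  boolean_number (ferrers (staircase r)) = boolean_number (half_graph r).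
Proof.
have sz := size_staircase r; have hd := head_staircase r.
pose f (u : ferrers (staircase r)) : half_graph r :=
  match u with
  | inl i => inl (cast_ord sz i) | inr j => inr (rev_ord (cast_ord hd j))
  end.
pose g (u : half_graph r) : ferrers (staircase r) :=
  match u with
  | inl i => inl (cast_ord (esym sz) i)
  | inr j => inr (cast_ord (esym hd) (rev_ord j))
  end.
apply: (@boolean_number_iso _ _ f).
  exists g => -[i|j] /=; rewrite ?rev_ordK ?cast_ordK ?cast_ordKV ?rev_ordK //.
have E (i : 'I_(size (staircase r))) (j : 'I_(head 0 (staircase r))) :
    (i <= r - j.+1) = (j < nth 0 (staircase r) i).
  have ir : i < r by rewrite -[X in _ < X]sz.
  have jr : j < r by rewrite -[X in _ < X]hd.
  by rewrite nth_staircase //; lia.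
by move=> [i|j] [i'|j'] //=; apply: E.
Qed.

(** * Counting by the set of values seen so far *)

Section Seen.
Variable T : finType.
Implicit Types (S : {set T}) (n : nat).

Definition seen S n (c : {ffun 'I_n -> T}) (j : 'I_n) : {set T} :=
  S :|: [set c i | i : 'I_n & i <= j].

Definition ffcons n (p : T * {ffun 'I_n -> T}) : {ffun 'I_n.+1 -> T} :=
  [ffun i => if unlift ord0 i is Some k then p.2 k else p.1].

Lemma ffcons_bij n : bijective (@ffcons n).
Proof.
exists (fun c : {ffun 'I_n.+1 -> T} =>
          (c ord0, [ffun k => c (lift ord0 k)])) => [[a c]|c] /=.
  congr pair; first by rewrite ffunE unlift_none.
  by apply/ffunP => k; rewrite !ffunE liftK.
by apply/ffunP => i; rewrite ffunE /=; case: unliftP => [k|] -> //; rewrite ffunE.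
Qed.

Lemma seen_ffcons0 S n a (c : {ffun 'I_n -> T}) :
  seen S (ffcons (a, c)) ord0 = a |: S.
Proof.
rewrite /seen setUC; congr (_ :|: _); apply/setP => b; rewrite inE.
apply/imsetP/eqP => [[i i0 ->]|->].
  have -> : i = ord0 by apply: val_inj; move: i0; rewrite inE /=; lia.
  by rewrite ffunE unlift_none.
by exists ord0; rewrite ?inE // ffunE unlift_none.
Qed.

Lemma seen_ffconsS S n a (c : {ffun 'I_n -> T}) (j : 'I_n) :
  seen S (ffcons (a, c)) (lift ord0 j) = seen (a |: S) c j.
Proof.
apply/setP => b; rewrite /seen !inE.
have -> : (b \in [set ffcons (a, c) i | i : 'I_n.+1 & i <= lift ord0 j])
          = (b == a) || (b \in [set c i | i : 'I_n & i <= j]).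
  apply/imsetP/orP => [[i]|[/eqP->|/imsetP[k kj ->]]].
  - rewrite inE ffunE; case: unliftP => [k|] -> /=; last by move=> _ ->; left.
    by move=> kj ->; right; apply/imsetP; exists k; rewrite // inE.
  - by exists ord0; rewrite ?inE // ffunE unlift_none.
  - by exists (lift ord0 k); rewrite ?ffunE ?liftK //; move: kj; rewrite !inE.
by rewrite orbCA orbA.
Qed.

End Seen.

(** [col_poly r k] is F(r, k - 1) of the introduction: [k] counts the blank as
    one of the seen values, so that it is the cardinal of a set of values. *)
Fixpoint col_poly (r k : nat) : {poly int} :=
  if r isn't r'.+1 then 1%R else
  (k%:R * ('X + 2 - k%:R) * col_poly r' k
   + ('X + 1 - k%:R) ^+ 2 * col_poly r' k.+1)%R.

Lemma horner_col_polyS r k (x : int) :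
  ((col_poly r.+1 k).[x] =
   k%:R * (x + 2 - k%:R) * (col_poly r k).[x]
   + (x + 1 - k%:R) ^+ 2 * (col_poly r k.+1).[x])%R.
Proof.
have hn m : ((m%:R : {poly int}).[x] = m%:R)%R by rewrite -polyC_natr hornerC.
by rewrite /= expr2 !(hornerD, hornerM, hornerN, hornerX, hornerC, hn).
Qed.

(** When [T] is the set of colours with a blank, and the blank is in [S], the
    factor is the number of values that y_j can take: those not in [seen S c j],
    and the blank.  The induction moves the value at index 0 into [S], hence the
    arbitrary initial set; only its cardinal matters, because [T] has [#|S|]
    elements that leave it unchanged and [q + 1 - #|S|] that enlarge it. *)
Lemma sum_seen (T : finType) n (S : {set T}) (q : nat) : #|T| = q.+1 ->
  (\sum_(c : {ffun 'I_n -> T}) \prod_j (q%:R + 2 - #|seen S c j|%:R)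
   = (col_poly n #|S|).[q%:R] :> int)%R.
Proof.
move=> cT; elim: n S => [|n IH] S.
  rewrite hornerC; under eq_bigr => c _ do rewrite big_ord0.
  by rewrite sumr_const card_ffun card_ord.
rewrite (reindex (@ffcons T n)) /=; last by apply: onW_bij; apply: ffcons_bij.
rewrite -(pair_bigA _ (fun a c => \prod_j (q%:R + 2 -
  #|seen S (ffcons (a, c)) j|%:R : int)))%R /=.
under eq_bigr => a _.
  under eq_bigr => c _.
    rewrite big_ord_recl seen_ffcons0.
    under eq_bigr => j _ do rewrite seen_ffconsS.
    over.
  rewrite -mulr_sumr IH; over.
rewrite horner_col_polyS (bigID (mem S)) /=; congr (_ + _)%R.
  under eq_bigr => a aS do rewrite (setUidPr _) ?sub1set //.
  by rewrite sumr_const -[LHS]mulr_natl mulrA.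
under eq_bigr => a aS do rewrite cardsU1 aS /=.
rewrite sumr_const -[LHS]mulr_natl.
have -> : #|[pred a | a \notin S]| = (q.+1 - #|S|)%N.
  by rewrite -cT -(cardC (mem S)) addKn; apply: eq_card => a; rewrite !inE.
have Sq : #|S| <= q.+1 by rewrite -cT max_card.
by rewrite natrB // add1n -!natr1; ring.
Qed.

(** * Partial colourings of half graphs *)

(** Once the colours [c] of the x side are fixed, the y vertices are coloured
    independently of each other. *)
Lemma card_partial_col_half n q :
  #|partial_col (half_graph n) q| =
  \sum_(c : {ffun 'I_n -> option 'I_q}) \prod_(j : 'I_n)
     (q.+2 - #|seen [set None] c j|).
Proof.
pose ffT := {ffun 'I_n -> option 'I_q}.
pose X (f : {ffun half_graph n -> option 'I_q}) : ffT := [ffun i => f (inl i)].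
pose Y (f : {ffun half_graph n -> option 'I_q}) : ffT := [ffun i => f (inr i)].
pose join (p : ffT * ffT) : {ffun half_graph n -> option 'I_q} :=
  [ffun u => match u with inl i => p.1 i | inr j => p.2 j end].
pose ok (c : ffT) j : {set option 'I_q} := None |: ~: seen [set None] c j.
have okP (c d : ffT) : (d \in family (ok c)) = (join (c, d) \in partial_col _ q).
  apply/familyP/partial_colP => [cd|cd j].
    have K (i j : 'I_n) : i <= j -> c i = d j -> c i = None.
      move=> ij cij; have := cd j; rewrite !inE -cij; case: (c i =P None) => //= _.
      by case/negP; apply/imsetP; exists i; rewrite ?inE.
    move=> [i|i] [j|j] //= ij; rewrite !ffunE /= => E; first exact: K ij E.
    by rewrite E; apply: K ij (esym E).
  rewrite !inE; case: eqP => //= dj; apply/imsetP => -[i].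
  rewrite inE => ij E; apply: dj; have := cd (inl i) (inr j) ij.
  by rewrite !ffunE /= E; apply.
(* The blank is seen from the start and stays allowed: it is counted twice. *)
have card_ok c j : #|ok c j| = q.+2 - #|seen [set None] c j|.
  have Ns : None \in seen [set None] c j by rewrite !inE eqxx.
  rewrite cardsU1 in_setC Ns /= cardsCs setCK card_option card_ord.
  have := max_card (seen [set None] c j); rewrite card_option card_ord.
  by move: #|_| => m; lia.
under eq_bigr => c _.
  under eq_bigr => j _ do rewrite -card_ok.
  have -> : \prod_(j : 'I_n) #|ok c j| = #|family (ok c)|.
    by rewrite card_family foldrE big_map big_enum.
  rewrite -sum1_card; over.
rewrite pair_big_dep /= sum1_card.
transitivity #|[set p : ffT * ffT | p.2 \in family (ok p.1)]|; last first.
  by rewrite cardsE.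
symmetry; apply: (@card_bij _ _ _ _ join (fun f => (X f, Y f))).
  move=> [c d]; rewrite in_set okP => cd; split=> //.
  by congr pair; apply/ffunP => i; rewrite !ffunE.
move=> f fP; have E : join (X f, Y f) = f.
  by apply/ffunP => -[i|i]; rewrite !ffunE.
by split; rewrite // in_set okP E.
Qed.

Lemma is_boolean_poly_half n : is_boolean_poly (half_graph n) (col_poly n 1).
Proof.
move=> q; rewrite -(cards1 (@None 'I_q)) -sum_seen ?card_option ?card_ord //.
rewrite card_partial_col_half natr_sum; apply: eq_bigr => c _.
rewrite natr_prod; apply: eq_bigr => j _.
have := max_card (seen [set None] c j); rewrite card_option card_ord => le.
by rewrite natrB ?(leqW le) // -[q.+2]addn2 natrD.
Qed.

(** * The value at -1 *)

Lemma col_poly_genocchi r x :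
  ((col_poly r x.+1).[-1] = genocchi2_at r.+1 x)%R.
Proof.
elim: r x => [|r IH] x; first by rewrite hornerC.
rewrite horner_col_polyS !IH /=.
by rewrite -natr1; ring.
Qed.

Lemma boolean_number_half r :
  ((boolean_number (half_graph r.+1))%:R = genocchi2 r.+1 :> int)%R.
Proof.
have [p Hp <-] := boolean_poly_exists (half_graph r.+1).
rewrite (boolean_poly_uniq Hp (@is_boolean_poly_half r.+1)).
have -> : #|half_graph r.+1| = r.+1.*2 by rewrite card_sum card_ord addnn.
rewrite -mul2n exprM sqrrN !expr1n mul1r.
by rewrite horner_col_polyS !col_poly_genocchi /genocchi2; ring.
Qed.

Theorem corollary5p4 (r : nat) (hr : 1 <= r) :
  (boolean_number (ferrers (staircase r)))%:Z%R = genocchi2 r.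
Proof.
case: r hr => // r _.
by rewrite boolean_number_staircase -boolean_number_half natz.
Qed.
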